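(* Let $\mathcal G$ be a finite groupoid and let $n\ge 1$. The $S^1$-transgression map on the cocycle level, $\tau\colon Z^{n}(\mathcal G,U(1))\to Z^{n-1}(\Lambda\mathcal G,U(1))$, is given on a cocycle $\alpha\in Z^n(\mathcal G,U(1))$ by $$\tau(\alpha)([g_{n-1}|\ldots|g_1]\gamma)=\prod_{i=0}^{n-1}\alpha\bigl([\,g_{n-1}|\ldots|g_{i+1}\,|\,(g_i\cdots g_1)\gamma(g_i\cdots g_1)^{-1}\,|\,g_i|\ldots|g_1\,]\bigr)^{(-1)^{n-1-i}}.$$
   Context: A finite groupoid is a category with finitely many objects and morphisms in which every morphism is invertible; $g_2g_1=g_2\circ g_1$ means first $g_1$, then $g_2$. Classifying space. $\mathcal B\mathcal G$ has one $n$-simplex $[g_n|\ldots|g_1]$ for each composable string $x_n\xleftarrow{g_n}\cdots\xleftarrow{g_1}x_0$ (a $0$-simplex is an object), parametrized by coordinates $0\le t_n\le\dots\le t_1\le1$; its points are written $[g_n,t_n|\ldots|g_1,t_1]$. The simplex is oriented by the coordinate order $(t_1,\dots,t_n)$. Faces are glued by: if $t_1=1$ drop the entry $g_1$; if $t_{i+1}=t_i$ replace the two entries $g_{i+1},g_i$ by $g_{i+1}g_i$; if $t_n=0$ drop the entry $g_n$. Cocycles. A (normalized) $U(1)$-valued $n$-cochain on $\mathcal G$ is a function from $n$-simplices of $\mathcal B\mathcal G$ to $U(1)$ which equals $1$ on any string containing an identity morphism. It is extended multiplicatively to integral simplicial chains. It is an $n$-cocycle if it is trivial on the boundary of every $(n+1)$-simplex,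 i.e. $\omega([g_n|\ldots|g_1])\,\omega([g_{n+1}g_n|\ldots|g_1])^{-1}\cdots\omega([g_{n+1}|\ldots|g_2g_1])^{\pm1}\omega([g_{n+1}|\ldots|g_2])^{\mp1}=1$. $Z^n(\mathcal G,U(1))$ is the group of $n$-cocycles. Loop groupoid. $\Lambda\mathcal G$ has as objects all self-morphisms $\gamma\in\mathrm{Mor}_{\mathcal G}(x,x)$, and a morphism $g\colon\gamma\to g\gamma g^{-1}$ for each $\gamma\in\mathrm{Mor}_{\mathcal G}(x,x)$ and $g\in\mathrm{Mor}_{\mathcal G}(x,y)$, with composition from $\mathcal G$. The simplex with initial object $\gamma$ and successive morphisms $g_1,\dots,g_m$ is written $[g_m|\ldots|g_1]\gamma$. Transgression. Let $S^1=[0,1]/(0\sim1)$. The evaluation map $\mathrm{ev}\colon\mathcal B\Lambda\mathcal G\times S^1\to\mathcal B\mathcal G$ is $$\mathrm{ev}([g_m,t_m|\ldots|g_1,t_1]\gamma,\,t)=[g_m,t_m|\ldots|g_{i+1},t_{i+1}\,|\,(g_i\cdots g_1)\gamma(g_i\cdots g_1)^{-1},t\,|\,g_i,t_i|\ldots|g_1,t_1]\quad\text{for }t_i\ge t\ge t_{i+1}$$ ($t_0=1$, $t_{m+1}=0$); it is the adjoint of the Parmesan map $\mathcal B\Lambda\mathcal G\to\mathrm{Maps}(S^1,\mathcal B\mathcal G)$. For an $m$-simplex $\sigma$ of $\mathcal B\Lambda\mathcal G$, the prism $\sigma\times[0,1]$, with product orientation given by the coordinate order $(t_1,\dots,t_m,t)$,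 is decomposed into the $m+1$ simplices $\{t_i\ge t\ge t_{i+1}\}$, $0\le i\le m$. Each of these is mapped by $\mathrm{ev}$ onto a simplex of $\mathcal B\mathcal G$; let $\mathrm{ev}_*(\sigma\times S^1)$ be the signed sum of these image simplices, the sign comparing the coordinate-order orientation of the simplex with the product orientation. The $S^1$-transgression is $\tau(\alpha)(\sigma):=\alpha(\mathrm{ev}_*(\sigma\times S^1))$ for $\sigma$ an $(n-1)$-simplex. *)

(* Defs.v *)
From HB Require Import structures.
From Stdlib Require Import Relation_Operators.
From mathcomp Require Import all_boot all_order all_algebra all_fingroup.
From mathcomp Require Import generic_quotient boolp reals complex.
Set Implicit Arguments.
Unset Strict Implicit.
Unset Printing Implicit Defensive.
Import Order.TTheory GRing.Theory Num.Theory.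
Local Open Scope ring_scope.
Local Open Scope quotient_scope.

(* [gcomp h g] is h after g; composition is a total operation constrained by
   the axioms only when [gsrc h = gtgt g]. *)
Record finGroupoid : Type := FinGroupoid {
  gobj : finType;
  gmor : finType;
  gsrc : gmor -> gobj;
  gtgt : gmor -> gobj;
  gid : gobj -> gmor;
  gcomp : gmor -> gmor -> gmor;
  ginv : gmor -> gmor;
  gsrc_id : forall x, gsrc (gid x) = x;
  gtgt_id : forall x, gtgt (gid x) = x;
  gsrc_comp : forall h g, gsrc h = gtgt g -> gsrc (gcomp h g) = gsrc g;
  gtgt_comp : forall h g, gsrc h = gtgt g -> gtgt (gcomp h g) = gtgt h;
  gcompA : forall k h g, gsrc k = gtgt h -> gsrc h = gtgt g ->
    gcomp k (gcomp h g) = gcomp (gcomp k h) g;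
  gcomp1l : forall g, gcomp (gid (gtgt g)) g = g;
  gcomp1r : forall g, gcomp g (gid (gsrc g)) = g;
  gsrc_inv : forall g, gsrc (ginv g) = gtgt g;
  gtgt_inv : forall g, gtgt (ginv g) = gsrc g;
  gcompVl : forall g, gcomp (ginv g) g = gid (gsrc g);
  gcompVr : forall g, gcomp g (ginv g) = gid (gtgt g)
}.
Arguments gid {f} _.

Section Strings.
Variable G : finGroupoid.
Implicit Types (x : gobj G) (g : gmor G) (gs : seq (gmor G)).

(* A string x_n <-g_n- ... <-g_1- x_0 is stored as x_0 together with the list
   [:: g_1; ...; g_n], i.e. in the order in which the morphisms are applied. *)
Fixpoint composable x gs : bool :=
  if gs is g :: gs' then (gsrc g == x) && composable (gtgt g) gs' else true.

Definition endpoint x gs : gobj G := last x (map (@gtgt G) gs).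

(* g_n ... g_1 *)
Definition gprod x gs : gmor G := foldl (fun h g => gcomp g h) (gid x) gs.

(* g c g^-1 *)
Definition gconj g c : gmor G := gcomp (gcomp g c) (ginv g).

(* Multiplies the 0-indexed entries k and k+1, or drops entry k if it is the
   last one. *)
Fixpoint merge_at (k : nat) gs : seq (gmor G) :=
  match k, gs with
  | 0, g1 :: g2 :: gs' => gcomp g2 g1 :: gs'
  | 0, _ => [::]
  | k'.+1, g :: gs' => g :: merge_at k' gs'
  | _.+1, [::] => [::]
  end.

Lemma composable_cat x s1 s2 :
  composable x (s1 ++ s2) = composable x s1 && composable (endpoint x s1) s2.
Proof. by elim: s1 x => [|g s IH] x //=; rewrite IH andbA. Qed.

Lemma endpoint_cat x s1 s2 :
  endpoint x (s1 ++ s2) = endpoint (endpoint x s1) s2.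
Proof. by rewrite /endpoint map_cat last_cat. Qed.

Lemma composable_take x gs i : composable x gs -> composable x (take i gs).
Proof. by rewrite -{1}(cat_take_drop i gs) composable_cat => /andP[]. Qed.

Lemma gprod_ends x gs : composable x gs ->
  gsrc (gprod x gs) = x /\ gtgt (gprod x gs) = endpoint x gs.
Proof.
elim/last_ind: gs => [|gs g IH]; first by rewrite /gprod /= gsrc_id gtgt_id.
rewrite -cats1 composable_cat /= andbT => /andP[/IH[s1 t1] /eqP sg].
rewrite /gprod foldl_cat /= -/(gprod x gs).
by rewrite gsrc_comp ?t1 // gtgt_comp ?t1 // endpoint_cat.
Qed.

Lemma gconj_ends g c : gsrc c = gsrc g -> gtgt c = gsrc g ->
  gsrc (gconj g c) = gtgt g /\ gtgt (gconj g c) = gtgt g.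
Proof.
move=> sc tc; have tgc : gtgt (gcomp g c) = gtgt g by rewrite gtgt_comp.
have sgc : gsrc (gcomp g c) = gsrc g by rewrite gsrc_comp.
by rewrite /gconj gsrc_comp ?gtgt_comp ?gsrc_inv ?gtgt_inv ?sgc ?tgc.
Qed.

Lemma size_merge_at k gs : (k < size gs)%N -> size (merge_at k gs) = (size gs).-1.
Proof.
elim: k gs => [|k IH] [|g gs] //=; first by case: gs.
by rewrite ltnS => h; rewrite IH //; case: gs h.
Qed.

Lemma composable_merge_at k x gs : composable x gs -> composable x (merge_at k gs).
Proof.
elim: k x gs => [|k IH] x [|g gs] //=; last by move=> /andP[-> /IH].
case: gs => [|h gs] //= /and3P[/eqP sg /eqP sh c].
by rewrite gsrc_comp // gtgt_comp // sg eqxx.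
Qed.

End Strings.

Definition insert_at (T : Type) (i : nat) (e : T) (s : seq T) : seq T :=
  take i s ++ e :: drop i s.

Lemma size_insert_at (T : Type) i (e : T) s :
  size (insert_at i e s) = (size s).+1.
Proof.
by rewrite /insert_at size_cat /= addnS -size_cat cat_take_drop.
Qed.

Lemma map_insert_at (T U : Type) (f : T -> U) i e s :
  map f (insert_at i e s) = insert_at i (f e) (map f s).
Proof. by rewrite /insert_at map_cat /= map_take map_drop. Qed.

(* (g_i ... g_1) c (g_i ... g_1)^-1 *)
Definition transport (G : finGroupoid) (x : gobj G) (gs : seq (gmor G))
  (c : gmor G) (i : nat) : gmor G := gconj (gprod x (take i gs)) c.

Lemma composable_insert (G : finGroupoid) (x : gobj G) gs c i :
    composable x gs -> gsrc c = x -> gtgt c = x ->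
  composable x (insert_at i (transport x gs c i) gs).
Proof.
move=> cgs sc tc; have ct := composable_take i cgs.
have [sp tp] := gprod_ends ct.
have [s1 t1] : gsrc (transport x gs c i) = endpoint x (take i gs) /\
    gtgt (transport x gs c i) = endpoint x (take i gs).
  by rewrite -tp; apply: gconj_ends; rewrite sp.
rewrite /insert_at composable_cat ct /= s1 t1 eqxx /=.
by move: cgs; rewrite -{1}(cat_take_drop i gs) composable_cat => /andP[].
Qed.

Section Cochains.
Variable G : finGroupoid.

(* [sx_start] is x_0, [sx_arrows] is [:: g_1; ...; g_n]. *)
Definition nsimplex (n : nat) : Type :=
  {s : gobj G * n.-tuple (gmor G) | composable s.1 s.2}.

Definition sx_start n (s : nsimplex n) : gobj G := (val s).1.
Definition sx_arrows n (s : nsimplex n) : n.-tuple (gmor G) := (val s).2.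

Definition mk_simplex n (x : gobj G) (gs : seq (gmor G))
    (szgs : size gs == n) (cgs : composable x gs) : nsimplex n :=
  @exist _ (fun s : gobj G * n.-tuple (gmor G) => composable s.1 s.2)
    (x, Tuple szgs) cgs.

Definition face_start (k : nat) (x : gobj G) (gs : seq (gmor G)) : gobj G :=
  if k is 0 then endpoint x (take 1 gs) else x.
Definition face_arrows (k : nat) (gs : seq (gmor G)) : seq (gmor G) :=
  if k is k'.+1 then merge_at k' gs else behead gs.

Lemma face_size n (s : nsimplex n.+1) (k : 'I_n.+2) :
  size (face_arrows k (sx_arrows s)) == n.
Proof.
case: k => [[|k] hk] /=; first by rewrite size_behead size_tuple.
by rewrite size_merge_at size_tuple.
Qed.

Lemma face_composable n (s : nsimplex n.+1) (k : 'I_n.+2) :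
  composable (face_start k (sx_start s) (sx_arrows s))
             (face_arrows k (sx_arrows s)).
Proof.
case: s => [[x gs] /= cgs]; rewrite /sx_start /sx_arrows /=.
case: k => [[|k] hk] /=; last exact: composable_merge_at.
by case: gs cgs => [[|g gs] /= sz] => [//|/andP[_]]; rewrite take0.
Qed.

(* The k-th face forgets the vertex x_k: it drops g_1 for k = 0, replaces
   g_{k+1}, g_k by g_{k+1} g_k for 0 < k < n+1, and drops g_{n+1} for k = n+1. *)
Definition face n (s : nsimplex n.+1) (k : 'I_n.+2) : nsimplex n :=
  mk_simplex (face_size s k) (face_composable s k).

(* Formal integral combinations: there are finitely many n-simplices. *)
Definition chain (n : nat) : Type := {ffun nsimplex n -> int}.

Definition basis_chain n (s : nsimplex n) : chain n :=
  [ffun s' => (s' == s)%:R].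

Definition boundary n (s : nsimplex n.+1) : chain n :=
  \sum_(k < n.+2) basis_chain (face s k) *~ (-1) ^+ (n.+1 - k).

Variable R : realType.

Definition on_chain n (w : nsimplex n -> R[i]) (c : chain n) : R[i] :=
  \prod_(s : nsimplex n) w s ^ c s.

Definition is_cochain n (w : nsimplex n -> R[i]) : Prop :=
  (forall s, `|w s| = 1) /\
  (forall s, (exists x : gobj G, gid x \in sx_arrows s) -> w s = 1).

Definition is_cocycle n (w : nsimplex n -> R[i]) : Prop :=
  is_cochain w /\ (forall s : nsimplex n.+1, on_chain w (boundary s) = 1).

End Cochains.

Section LoopGroupoid.
Variable G : finGroupoid.

Definition loop : Type := {c : gmor G | gsrc c == gtgt c}.

Definition loop_base (c : loop) : gobj G := gsrc (val c).

(* The pair (c, g) is the morphism g : c -> g c g^-1. *)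
Definition loop_mor : Type :=
  {p : gmor G * gmor G | (gsrc p.1 == gtgt p.1) && (gsrc p.2 == gsrc p.1)}.

Definition loop_arrow (p : loop_mor) : gmor G := (val p).2.

Lemma loop_mor_ends (p : loop_mor) :
  gtgt (val p).1 = gsrc (val p).1 /\ gsrc (val p).2 = gsrc (val p).1.
Proof. by case: p => [[c g] /= /andP[/eqP -> /eqP ->]]. Qed.

Lemma loop_src_subproof (p : loop_mor) : gsrc (val p).1 == gtgt (val p).1.
Proof. by have /andP[] := valP p. Qed.
Definition loop_src (p : loop_mor) : loop := Sub (val p).1 (loop_src_subproof p).

Lemma loop_tgt_subproof (p : loop_mor) :
  gsrc (gconj (val p).2 (val p).1) == gtgt (gconj (val p).2 (val p).1).
Proof.
have [tp sp] := loop_mor_ends p.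
by have [||-> ->] := @gconj_ends G (val p).2 (val p).1; rewrite ?tp ?sp.
Qed.
Definition loop_tgt (p : loop_mor) : loop :=
  Sub (gconj (val p).2 (val p).1) (loop_tgt_subproof p).

Lemma loop_id_subproof (c : loop) :
  (gsrc (val c) == gtgt (val c)) && (gsrc (@gid G (loop_base c)) == gsrc (val c)).
Proof. by rewrite (valP c) gsrc_id eqxx. Qed.
Definition loop_id (c : loop) : loop_mor :=
  Sub (val c, gid (loop_base c)) (loop_id_subproof c).

(* The default value of [insubd] is reached only for non-composable pairs. *)
Definition loop_comp (q p : loop_mor) : loop_mor :=
  insubd p ((val p).1, gcomp (val q).2 (val p).2).

Lemma loop_inv_subproof (p : loop_mor) :
  (gsrc (val (loop_tgt p)) == gtgt (val (loop_tgt p))) &&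
  (gsrc (ginv (val p).2) == gsrc (val (loop_tgt p))).
Proof.
rewrite (valP (loop_tgt p)) /= gsrc_inv; have [tp sp] := loop_mor_ends p.
by have [||-> _] := @gconj_ends G (val p).2 (val p).1; rewrite ?tp ?sp ?eqxx.
Qed.
Definition loop_inv (p : loop_mor) : loop_mor :=
  Sub (val (loop_tgt p), ginv (val p).2) (loop_inv_subproof p).

Lemma loop_composable (q p : loop_mor) :
  loop_src q = loop_tgt p -> gsrc (val q).2 = gtgt (val p).2.
Proof.
move=> /(congr1 val) /= e; have [tp sp] := loop_mor_ends p.
have [_ ->] := loop_mor_ends q; rewrite e.
by have [||] := @gconj_ends G (val p).2 (val p).1; rewrite ?tp ?sp.
Qed.

Lemma val_loop_comp (q p : loop_mor) : loop_src q = loop_tgt p ->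
  val (loop_comp q p) = ((val p).1, gcomp (val q).2 (val p).2).
Proof.
move=> /loop_composable e; have [tp sp] := loop_mor_ends p.
by rewrite val_insubd /= tp eqxx gsrc_comp ?e // sp eqxx.
Qed.

Lemma loop_src_comp q p : loop_src q = loop_tgt p ->
  loop_src (loop_comp q p) = loop_src p.
Proof. by move=> e; apply: val_inj; rewrite /= val_loop_comp. Qed.

Lemma ginv_unique (h g : gmor G) : gsrc h = gtgt g ->
  gcomp h g = gid (gsrc g) -> h = ginv g.
Proof.
move=> hg e; have: gcomp (gcomp h g) (ginv g) = gcomp (gid (gsrc g)) (ginv g).
  by rewrite e.
by rewrite -gcompA ?gtgt_inv // gcompVr -hg gcomp1r -(gtgt_inv g) gcomp1l.
Qed.

Lemma gconj_comp (h g c : gmor G) : gsrc h = gtgt g ->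
    gsrc c = gsrc g -> gtgt c = gsrc g ->
  gconj (gcomp h g) c = gconj h (gconj g c).
Proof.
move=> hg sc tc; rewrite /gconj.
have gVhV : gsrc (ginv g) = gtgt (ginv h) by rewrite gsrc_inv gtgt_inv.
have <- : gcomp (ginv g) (ginv h) = ginv (gcomp h g).
  apply: ginv_unique; first by rewrite gsrc_comp // gtgt_comp // gsrc_inv.
  rewrite -gcompA ?gtgt_comp ?gsrc_inv ?gtgt_inv //.
  rewrite (gcompA _ hg) ?gsrc_inv // gcompVl hg gcomp1l gcompVl.
  by rewrite gsrc_comp.
have sgc : gsrc (gcomp g c) = gsrc g by rewrite gsrc_comp.
have tgc : gtgt (gcomp g c) = gtgt g by rewrite gtgt_comp.
have hgc : gsrc h = gtgt (gcomp g c) by rewrite tgc.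
rewrite -(@gcompA _ h g c) ?tc //.
rewrite (@gcompA _ h (gcomp g c) (ginv g)) ?gtgt_comp ?sgc ?gtgt_inv //.
by rewrite (@gcompA _ (gcomp h (gcomp g c))) // gsrc_comp // sgc gtgt_inv.
Qed.

Lemma loop_tgt_comp q p : loop_src q = loop_tgt p ->
  loop_tgt (loop_comp q p) = loop_tgt q.
Proof.
move=> e; apply: val_inj; rewrite /= val_loop_comp //=.
have [tp sp] := loop_mor_ends p.
rewrite gconj_comp ?tp ?sp //; last exact: loop_composable.
by rewrite -[gconj (val p).2 _]/(val (loop_tgt p)) -e.
Qed.

Lemma loop_compA r q p : loop_src r = loop_tgt q -> loop_src q = loop_tgt p ->
  loop_comp r (loop_comp q p) = loop_comp (loop_comp r q) p.
Proof.
move=> rq qp; apply: val_inj.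
rewrite !val_loop_comp ?loop_src_comp ?loop_tgt_comp //=.
by rewrite gcompA //; apply: loop_composable.
Qed.

Lemma loop_comp1l p : loop_comp (loop_id (loop_tgt p)) p = p.
Proof.
have [tp sp] := loop_mor_ends p.
apply: val_inj; rewrite val_loop_comp /=; last exact: val_inj.
rewrite /loop_base /=; have [||-> _] := @gconj_ends G (val p).2 (val p).1.
- by rewrite sp.
- by rewrite tp sp.
by rewrite gcomp1l -surjective_pairing.
Qed.

Lemma loop_gconj1 (c : loop) : gconj (gid (loop_base c)) (val c) = val c.
Proof.
have /eqP e := valP c; rewrite /gconj /loop_base {1}e gcomp1l.
have <- : gid (gsrc (val c)) = ginv (gid (gsrc (val c))).
  apply: ginv_unique; first by rewrite gsrc_id gtgt_id.
  by rewrite -{2}(gsrc_id (gsrc (val c))) gcomp1r gsrc_id.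
by rewrite gcomp1r.
Qed.

Lemma loop_comp1r p : loop_comp p (loop_id (loop_src p)) = p.
Proof.
have [tp sp] := loop_mor_ends p.
apply: val_inj; rewrite val_loop_comp /=.
  by rewrite /loop_base /= -sp gcomp1r -surjective_pairing.
by apply: val_inj; rewrite /= (loop_gconj1 (loop_src p)).
Qed.

Lemma loop_src_id c : loop_src (loop_id c) = c.
Proof. exact: val_inj. Qed.

Lemma loop_tgt_id c : loop_tgt (loop_id c) = c.
Proof. by apply: val_inj; rewrite /= loop_gconj1. Qed.

Lemma loop_src_inv p : loop_src (loop_inv p) = loop_tgt p.
Proof. exact: val_inj. Qed.

Lemma loop_tgt_inv p : loop_tgt (loop_inv p) = loop_src p.
Proof.
have [tp sp] := loop_mor_ends p.
apply: val_inj; rewrite /= -gconj_comp ?gsrc_inv ?tp ?sp //.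
by rewrite gcompVl sp (loop_gconj1 (loop_src p)).
Qed.

Lemma loop_compVl p : loop_comp (loop_inv p) p = loop_id (loop_src p).
Proof.
have [tp sp] := loop_mor_ends p.
apply: val_inj; rewrite val_loop_comp ?loop_src_inv //=.
by rewrite gcompVl sp.
Qed.

Lemma loop_compVr p : loop_comp p (loop_inv p) = loop_id (loop_tgt p).
Proof.
have [tp sp] := loop_mor_ends p.
apply: val_inj; rewrite val_loop_comp ?loop_tgt_inv //= gcompVr /loop_base /=.
by have [||-> _] := @gconj_ends G (val p).2 (val p).1; rewrite ?tp ?sp.
Qed.

Definition loop_groupoid : finGroupoid :=
  FinGroupoid loop_src_id loop_tgt_id loop_src_comp loop_tgt_comp loop_compA
    loop_comp1l loop_comp1r loop_src_inv loop_tgt_inv loop_compVl loop_compVr.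

End LoopGroupoid.

Section ClassifyingSpace.
Variables (R : realType) (G : finGroupoid).

(* 1 >= t_1 >= ... >= t_n >= 0 *)
Definition in_simplex (ts : seq R) : bool := path >=%R 1 (rcons ts 0).

(* [g_n,t_n|...|g_1,t_1] is stored as (x_0, [:: (g_1,t_1); ...; (g_n,t_n)]). *)
Definition raw_point : Type := gobj G * seq (gmor G * R).
Definition is_point (p : raw_point) : bool :=
  composable p.1 (unzip1 p.2) && in_simplex (unzip2 p.2).
Definition point : Type := {p : raw_point | is_point p}.

Inductive glue : raw_point -> raw_point -> Prop :=
| glue_first x g s : glue (x, (g, 1) :: s) (gtgt g, s)
| glue_merge x s1 g1 g2 t s2 :
    glue (x, s1 ++ (g1, t) :: (g2, t) :: s2) (x, s1 ++ (gcomp g2 g1, t) :: s2)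
| glue_last x s g : glue (x, rcons s (g, 0)) (x, s).

Definition glued_prop : point -> point -> Prop :=
  clos_refl_sym_trans point (fun p q => glue (val p) (val q)).
Definition glued (p q : point) : bool := `[< glued_prop p q >].

Lemma glued_refl : reflexive glued.
Proof. by move=> p; apply/asboolP; apply: rst_refl. Qed.
Lemma glued_sym : symmetric glued.
Proof. by move=> p q; apply/asboolP/asboolP; apply: rst_sym. Qed.
Lemma glued_trans : transitive glued.
Proof.
by move=> q p r /asboolP pq /asboolP qr; apply/asboolP; apply: rst_trans pq qr.
Qed.
Canonical glued_equiv := EquivRel glued glued_refl glued_sym glued_trans.

(* The underlying set of the classifying space; the gluing involves faces only,
   degenerate simplices are not collapsed. *)
Definition classifying_space : Type := {eq_quot glued_equiv}.
HB.instance Definition _ := Quotient.on classifying_space.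

Lemma simplex_point_subproof n (s : nsimplex G n) (t : n.-tuple R) :
  in_simplex t -> is_point (sx_start s, zip (sx_arrows s) t).
Proof.
move=> ht; rewrite /is_point /= unzip1_zip ?unzip2_zip ?size_tuple // ht andbT.
exact: (valP s).
Qed.

Definition simplex_point n (s : nsimplex G n) (t : n.-tuple R)
    (ht : in_simplex t) : classifying_space :=
  \pi_classifying_space
    (Sub (sx_start s, zip (sx_arrows s) t) (simplex_point_subproof s ht) : point).

End ClassifyingSpace.

Section Circle.
Variable R : realType.

Definition unit_interval : Type := {t : R | 0 <= t <= 1}.

Definition circle_rel (s t : unit_interval) : bool :=
  (val s == val t) ||
  ((val s == 0) || (val s == 1)) && ((val t == 0) || (val t == 1)).

Lemma circle_refl : reflexive circle_rel.
Proof. by move=> s; rewrite /circle_rel eqxx. Qed.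
Lemma circle_sym : symmetric circle_rel.
Proof. by move=> s t; rewrite /circle_rel eq_sym andbC. Qed.
Lemma circle_trans : transitive circle_rel.
Proof.
rewrite /circle_rel => t s u /orP[/eqP -> //|/andP[-> h]] /orP[/eqP <-|/andP[_ ->]].
  by rewrite h orbT.
by rewrite orbT.
Qed.
Canonical circle_equiv := EquivRel circle_rel circle_refl circle_sym circle_trans.

Definition circle : Type := {eq_quot circle_equiv}.
HB.instance Definition _ := Quotient.on circle.

End Circle.

Section Evaluation.
Variables (R : realType) (G : finGroupoid).
Local Notation LG := (loop_groupoid G).

(* t_i >= u >= t_{i+1}, where t_0 = 1 and t_{n+1} = 0 *)
Definition in_piece (i : nat) (ts : seq R) (u : R) : bool :=
  [&& (i <= size ts)%N, u <= nth 0 (1 :: ts) i & nth 0 ts i <= u].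

Lemma in_simplex_insert ts i u :
  in_simplex ts -> in_piece i ts u -> in_simplex (insert_at i u ts).
Proof.
rewrite /in_simplex /in_piece /insert_at; elim: ts i (1 : R) => [|x ts IH] [|i] a //=.
- by rewrite !andbT => _ /andP[-> ->].
- by move=> /andP[_ ->] /andP[-> ->].
- by move=> /andP[-> h] /and3P[h1 h2 h3]; apply: IH => //; apply/and3P.
Qed.

Definition underlying_string (s : seq (gmor LG * R)) : seq (gmor G * R) :=
  [seq (loop_arrow e.1, e.2) | e <- s].

(* [g_m,t_m|...|g_{i+1},t_{i+1}|p c p^-1,u|g_i,t_i|...|g_1,t_1], p = g_i...g_1 *)
Definition ev_string (i : nat) (p : raw_point R LG) (u : R) : raw_point R G :=
  let x := loop_base p.1 in
  let gs := underlying_string p.2 in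
  (x, insert_at i (transport x (unzip1 gs) (val p.1) i, u) gs).

Lemma underlying_composable (c : gobj LG) (gs : seq (gmor LG)) :
  composable c gs -> composable (loop_base c) (map (@loop_arrow G) gs).
Proof.
elim: gs c => [|g gs IH] c //= /andP[/eqP <- /IH].
have [tg sg] := loop_mor_ends g.
rewrite {1}/loop_base /=; have [||-> _] := @gconj_ends G (val g).2 (val g).1.
- by rewrite sg.
- by rewrite tg sg.
by move=> ->; rewrite /loop_arrow sg /loop_base /= eqxx.
Qed.

Lemma unzip1_underlying s :
  unzip1 (underlying_string s) = map (@loop_arrow G) (unzip1 s).
Proof. by rewrite /unzip1 /underlying_string -!map_comp. Qed.

Lemma unzip2_underlying s : unzip2 (underlying_string s) = unzip2 s.
Proof. by rewrite /unzip2 /underlying_string -!map_comp. Qed.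

Lemma loop_ends (c : loop G) : gtgt (val c) = gsrc (val c).
Proof. by rewrite -(eqP (valP c)). Qed.

Lemma ev_string_is_point i (p : raw_point R LG) u :
  is_point p -> in_piece i (unzip2 p.2) u -> is_point (ev_string i p u).
Proof.
move=> /andP[cp tp] hi; apply/andP; split; rewrite /ev_string /=.
  rewrite /unzip1 map_insert_at /= -/(unzip1 _) unzip1_underlying.
  by apply: composable_insert; rewrite ?loop_ends //; exact: underlying_composable.
rewrite /unzip2 map_insert_at -/(unzip2 _) unzip2_underlying.
exact: in_simplex_insert.
Qed.

(* The largest i with t_i >= u. *)
Definition piece_index (ts : seq R) (u : R) : nat := count (fun t => u <= t) ts.

Lemma in_piece_index ts u : in_simplex ts -> 0 <= u <= 1 ->
  in_piece (piece_index ts u) ts u.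
Proof.
rewrite /in_simplex /in_piece /piece_index => + /andP[u0].
rewrite count_size /=; elim: ts (1 : R) => [|x ts IH] a /=.
  by move=> _ ->; rewrite u0.
move=> /andP[xa h] ua; case: (leP u x) => [ux|xu] /=; first exact: IH.
have /allP hall : all (fun y => y < u) ts.
  have := order_path_min ge_trans h; rewrite all_rcons => /andP[_].
  by apply: sub_all => y yx; apply: le_lt_trans yx xu.
rewrite (_ : count _ _ = 0%N) /= ?ua ?ltW //.
apply/eqP; rewrite eqn0Ngt -has_count.
by apply/hasPn => y /hall; rewrite ltNge.
Qed.

Lemma ev_rep_subproof (p : point R LG) (u : unit_interval R) :
  is_point (ev_string (piece_index (unzip2 (val p).2) (val u)) (val p) (val u)).
Proof.
apply: ev_string_is_point (valP p) _; apply: in_piece_index (valP u).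
by have /andP[] := valP p.
Qed.
Definition ev_rep (p : point R LG) (u : unit_interval R) : point R G :=
  Sub (ev_string _ (val p) (val u)) (ev_rep_subproof p u).

(* Independent of the chosen representatives, and given by [ev_string i] on
   the whole piece t_i >= u >= t_{i+1}: see [ev_pi] below. *)
Definition ev (p : classifying_space R LG) (u : circle R) : classifying_space R G :=
  \pi_(classifying_space R G) (ev_rep (repr p) (repr u)).

Definition mk_point (p : raw_point R G) (h : is_point p) : point R G := Sub p h.

Lemma glued_step (p q : raw_point R G) (hp : is_point p) (hq : is_point q) :
  glue p q -> glued (mk_point hp) (mk_point hq).
Proof. by move=> h; apply/asboolP; apply: rst_step. Qed.

Lemma is_point_merge x s1 (g1 g2 : gmor G) (t : R) s2 :
  is_point (x, s1 ++ (g1, t) :: (g2, t) :: s2) ->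
  is_point (x, s1 ++ (gcomp g2 g1, t) :: s2).
Proof.
rewrite /is_point /in_simplex /= /unzip1 /unzip2 !map_cat /= -!/(unzip1 _) -!/(unzip2 _).
rewrite !composable_cat /= !rcons_cat !cat_path /=.
move=> /and3P[/and4P[-> /eqP <- /eqP h1 h2] -> /and3P[-> _ ->]] /=.
by rewrite gsrc_comp // gtgt_comp // eqxx h2.
Qed.

Lemma gconj_mulr (g c : gmor G) : gsrc g = gtgt c -> gsrc c = gsrc g ->
  gcomp (gconj g c) g = gcomp g c.
Proof.
move=> gc cg; have e : gsrc (gcomp g c) = gsrc g by rewrite gsrc_comp.
rewrite /gconj -gcompA ?gsrc_inv ?gtgt_inv ?e //.
by rewrite gcompVl -e gcomp1r.
Qed.

Lemma gprod_rcons x (s : seq (gmor G)) g : gprod x (rcons s g) = gcomp g (gprod x s).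
Proof. by rewrite /gprod -cats1 foldl_cat. Qed.

Lemma transport_ends x (s : seq (gmor G)) c i : composable x s ->
    gsrc c = x -> gtgt c = x ->
  gsrc (transport x s c i) = endpoint x (take i s) /\
  gtgt (transport x s c i) = endpoint x (take i s).
Proof.
move=> cs sc tc; have [sp tp] := gprod_ends (composable_take i cs).
by rewrite -tp; apply: gconj_ends; rewrite sp.
Qed.

Lemma transportS x (s1 s2 : seq (gmor G)) g c : composable x (s1 ++ g :: s2) ->
    gsrc c = x -> gtgt c = x ->
  transport x (s1 ++ g :: s2) c (size s1).+1 =
  gconj g (transport x (s1 ++ g :: s2) c (size s1)).
Proof.
move=> cs sc tc; rewrite /transport.
rewrite take_cat ltnNge leqnSn /= subSnn /= take0 cats1 gprod_rcons.
rewrite take_size_cat //; move: cs; rewrite composable_cat => /andP[c1 /andP[/eqP sg _]].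
have [sp tp] := gprod_ends c1.
by rewrite gconj_comp ?tp ?sp.
Qed.

Lemma ev_string_step i (p : raw_point R LG) u (hp : is_point p)
    (h : in_piece i (unzip2 p.2) u) (h' : in_piece i.+1 (unzip2 p.2) u) :
  glued (mk_point (ev_string_is_point hp h)) (mk_point (ev_string_is_point hp h')).
Proof.
move: (ev_string_is_point hp h) (ev_string_is_point hp h') => pi pi'.
have /andP[cp _] := hp.
have lt_i : (i < size p.2)%N by case/and3P: h' => []; rewrite size_map.
have tu : nth 0 (unzip2 p.2) i = u.
  by apply/le_anti; case/and3P: h => _ _ ->; case/and3P: h' => _ ->.
move: pi pi'; rewrite /ev_string; set gs := underlying_string p.2.
have sgs : size gs = size p.2 by rewrite size_map.
have cgs : composable (loop_base p.1) (unzip1 gs).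
  by rewrite unzip1_underlying; apply: underlying_composable.
have tgs : nth 0 (unzip2 gs) i = u by rewrite unzip2_underlying.
move: (lt_i) cgs tgs; rewrite -sgs => {}lt_i.
have := cat_take_drop i gs; have /size_takel := ltnW lt_i.
case E : (drop i gs) => [|[g t] s2].
  by move=> _ _; move: lt_i; rewrite -subn_gt0 -size_drop E.
move: (take i gs) => s1 ss1 <-; rewrite -{i h h' lt_i E tu}ss1.
rewrite /insert_at take_size_cat // drop_size_cat //.
rewrite take_cat ltnNge leqnSn /= subSnn /= take0.
rewrite drop_cat ltnNge leqnSn /= subSnn /= drop0.
rewrite /unzip1 /unzip2 !map_cat /= -!/(unzip1 _) -!/(unzip2 _) => cgs.
rewrite nth_cat size_map ltnn subnn /= => ->.
set c := transport _ _ _ (size s1) => pi pi'.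
have [sc tc] : gsrc c = endpoint (loop_base p.1) (unzip1 s1) /\
    gtgt c = endpoint (loop_base p.1) (unzip1 s1).
  have := transport_ends (size s1) cgs (erefl (loop_base p.1)) (loop_ends p.1).
  by rewrite take_size_cat ?size_map.
have := transportS cgs (erefl (loop_base p.1)) (loop_ends p.1).
rewrite size_map -/c => e; move: pi'; rewrite -catA /= e => pi'.
have sg : gsrc g = endpoint (loop_base p.1) (unzip1 s1).
  by move: cgs; rewrite composable_cat => /and3P[_ /eqP].
have m1 := glued_step pi (is_point_merge pi) (glue_merge _ _ _ _ _ _).
have m2 := glued_step pi' (is_point_merge pi') (glue_merge _ _ _ _ _ _).
apply: (glued_trans m1); rewrite glued_sym (_ : mk_point (is_point_merge pi) =
  mk_point (is_point_merge pi')) //.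
by apply: val_inj; rewrite /= gconj_mulr ?tc ?sc ?sg.
Qed.

Lemma nth_desc (a : R) ts i j : path >=%R a (rcons ts 0) -> (i <= j)%N ->
  nth 0 (a :: ts) j <= nth 0 (a :: ts) i.
Proof.
elim: ts a i j => [|x ts IH] a [|i] [|j] //=.
- by case: j => [|j] /andP[].
- by rewrite !nth_nil.
- by move=> /andP[xa h] _; apply: le_trans xa; apply: (IH x 0%N j).
- by move=> /andP[xa h] ij; apply: (IH x i j).
Qed.

Lemma ev_string_glued i j (p : raw_point R LG) u (hp : is_point p)
    (h : in_piece i (unzip2 p.2) u) (h' : in_piece j (unzip2 p.2) u) :
  glued (mk_point (ev_string_is_point hp h)) (mk_point (ev_string_is_point hp h')).
Proof.
wlog ij : i j h h' / (i <= j)%N.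
  by move=> W; case: (leqP i j) => ij; [|rewrite glued_sym]; apply: W => //; apply: ltnW.
have [_ tp] := andP hp.
elim: j ij h' => [|j IH] ij h'.
  move: ij; rewrite leqn0 => /eqP ij; move: h h'; rewrite ij => h h'.
  by rewrite (bool_irrelevance h h') glued_refl.
move: ij; rewrite leq_eqVlt => /orP[/eqP ij|ij].
  clear IH; move: h h'; rewrite ij => h h'.
  by rewrite (bool_irrelevance h h') glued_refl.
have hj : in_piece j (unzip2 p.2) u.
  case/and3P: (h) => _ _ h2; case/and3P: (h') => h3 h4 _.
  apply/and3P; split; first exact: ltnW.
    exact: le_trans h4 (nth_desc tp (leqnSn j)).
  by apply: le_trans h2; apply: (nth_desc tp (i := i.+1) (j := j.+1)).
exact: glued_trans (IH ij hj) (ev_string_step hp hj h').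
Qed.

Lemma insert_at_cat (T : Type) i (e : T) s1 s2 : insert_at i e (s1 ++ s2) =
  if (i <= size s1)%N then insert_at i e s1 ++ s2
  else s1 ++ insert_at (i - size s1) e s2.
Proof.
rewrite /insert_at take_cat drop_cat.
case: (ltngtP i (size s1)) => [i1|i1|i1]; rewrite -?catA //.
by rewrite i1 subnn take0 drop0 take_size drop_size.
Qed.

Lemma gcomp_loop (q p : gmor LG) : gsrc q = gtgt p ->
  loop_arrow (gcomp q p) = gcomp (loop_arrow q) (loop_arrow p).
Proof. by move=> e; rewrite /loop_arrow /= val_loop_comp. Qed.

Lemma gprod_cons x g (s : seq (gmor G)) : gsrc g = x -> composable (gtgt g) s ->
  gprod x (g :: s) = gcomp (gprod (gtgt g) s) g.
Proof.
move=> sg; elim/last_ind: s => [|s h IH] cs.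
  by rewrite /gprod /= gcomp1l -sg gcomp1r.
move: cs; rewrite -rcons_cons !gprod_rcons -cats1 composable_cat /= andbT.
move=> /andP[cs /eqP sh]; rewrite IH // gcompA //.
  by have [_ ->] := gprod_ends cs.
by have [-> _] := gprod_ends cs.
Qed.

Lemma glue_ev_string (p q : raw_point R LG) j u : is_point p -> is_point q ->
    glue p q -> in_piece j (unzip2 q.2) u ->
  exists2 i, in_piece i (unzip2 p.2) u & glue (ev_string i p u) (ev_string j q u).
Proof.
move=> + + pq; case: pq => [c g s|c s1 g1 g2 t s2|c s g].
- move=> /andP[/= /andP[/eqP sg cs] _] _ hj; exists j.+1.
    by move: hj; rewrite /in_piece /= => /and3P[? ? ?]; apply/and3P.
  rewrite /ev_string /= /insert_at /=.
  have cs' : composable (loop_base (gtgt g)) (take j (unzip1 (underlying_string s))).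
    by apply: composable_take; rewrite unzip1_underlying; apply: underlying_composable.
  have [tg0 sg0] := loop_mor_ends g.
  have eb : loop_base (gtgt g) = gtgt (loop_arrow g).
    by rewrite /loop_base /=; have [||-> _] := @gconj_ends G (val g).2 (val g).1;
       rewrite ?tg0 ?sg0.
  have -> : transport (loop_base c) (loop_arrow g :: unzip1 (underlying_string s))
      (val c) j.+1 =
    transport (loop_base (gtgt g)) (unzip1 (underlying_string s)) (val (gtgt g)) j.
    rewrite /transport /= gprod_cons.
    - rewrite eb gconj_comp.
      + by rewrite -sg.
      + by rewrite -eb; have [-> _] := gprod_ends cs'.
      + by rewrite -sg /loop_arrow sg0.
      + by rewrite -sg /loop_arrow sg0 tg0.
    - by rewrite /loop_arrow sg0 -sg.
    - by rewrite -eb.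
  by rewrite eb; apply: glue_first.
- move=> /andP[/= + _] _.
  rewrite /unzip1 !map_cat /= -!/(unzip1 _) composable_cat /= =>
    /and4P[c1 /eqP sg1 /eqP sg2 c2] hj.
  have ce : composable (loop_base c) (map (@loop_arrow G) (unzip1 s1 ++ g1 :: g2 :: unzip1 s2)).
    by apply: underlying_composable; rewrite composable_cat /= c1 sg1 sg2 c2 !eqxx.
  move: ce; rewrite map_cat /= -!unzip1_underlying => ce.
  have sz : size (underlying_string s1) = size s1 by rewrite size_map.
  case: (leqP j (size s1)) => js.
    exists j.
      move: hj; rewrite /in_piece /unzip2 !map_cat !size_cat /= !size_map.
      move=> /and3P[j1 j2 j3]; apply/and3P; split.
      + by apply: leq_trans js (leq_addr _ _).
      + by move: j2; rewrite -!cat_cons !nth_cat /= size_map ltnS js.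
      + move: j3; rewrite !nth_cat size_map; case: ltnP => // h.
        by have -> : (j - size s1 = 0)%N by apply/eqP; rewrite subn_eq0.
    rewrite /ev_string /= /underlying_string !map_cat /= -!/(underlying_string _).
    rewrite gcomp_loop // !insert_at_cat sz js.
    rewrite /transport /unzip1 !map_cat !takel_cat ?size_map //.
    exact: glue_merge.
  have N1 : (j < size s1)%N = false by rewrite ltnNge ltnW.
  have N2 : (j.+1 < size s1)%N = false by rewrite ltnNge ltnW // ltnW.
  have N3 : (j <= size s1)%N = false by rewrite leqNgt js.
  exists j.+1.
    move: hj; rewrite /in_piece /unzip2 !map_cat !size_cat /= !size_map.
    move=> /and3P[j1 j2 j3]; apply/and3P; split.
    + by rewrite addnS ltnS.
    + by move: j2; rewrite -!cat_cons !nth_cat /= size_map !ltnS N3 N1 -(subnSK js).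
    + by move: j3; rewrite !nth_cat size_map N1 N2 subSn ?(ltnW js).
  rewrite /ev_string /= /underlying_string !map_cat /= -!/(underlying_string _).
  rewrite gcomp_loop // !insert_at_cat sz.
  rewrite N3 N1 /= subSn ?(ltnW js) //.
  set e1 := transport _ _ _ _; set e2 := transport _ _ _ _.
  have -> : e1 = e2.
    rewrite /e1 /e2 /transport; congr gconj.
    rewrite /unzip1 !map_cat /= -!/(unzip1 _) !take_cat size_map sz.
    rewrite N1 N2 /= subSn ?(ltnW js) //.
    case: (j - size s1)%N (subn_gt0 (size s1) j) => [|k]; first by rewrite js.
    move=> _ /=; rewrite /gprod !foldl_cat /= -/(gprod _ _).
    congr foldl; move: ce; rewrite composable_cat => /and4P[ce /eqP s1' /eqP s2' _].
    by rewrite gcompA //; have [_ ->] := gprod_ends ce.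
  case: (j - size s1)%N (subn_gt0 (size s1) j) => [|k]; first by rewrite js.
  by move=> _; rewrite /insert_at /=; apply: glue_merge.
- move=> _ _ hj; exists j.
    move: hj; rewrite /in_piece /= /unzip2 map_rcons size_rcons /= => /and3P[j1 j2 j3].
    apply/and3P; split; first exact: leqW.
      by rewrite -rcons_cons nth_rcons /= ltnS j1.
    by rewrite nth_rcons; case: ltnP j3 => // h; rewrite nth_default //; case: eqP.
  have js : (j <= size s)%N by case/and3P: hj; rewrite size_map.
  rewrite /ev_string /= /underlying_string map_rcons /= -/(underlying_string s).
  rewrite -cats1 insert_at_cat size_map js.
  rewrite /transport /unzip1 map_cat takel_cat ?size_map // cats1.
  exact: glue_last.
Qed.

Lemma ev_rep_glued i (p : point R LG) (u : unit_interval R)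
    (h : in_piece i (unzip2 (val p).2) (val u)) :
  glued (ev_rep p u) (mk_point (ev_string_is_point (valP p) h)).
Proof.
have jp : in_piece (piece_index (unzip2 (val p).2) (val u)) (unzip2 (val p).2) (val u).
  by apply: in_piece_index (valP u); have /andP[] := valP p.
have := ev_string_glued (valP p) jp h.
by rewrite (bool_irrelevance (ev_string_is_point _ jp) (ev_rep_subproof p u)).
Qed.

Lemma glued_ev_rep (p q : point R LG) u :
  glued p q -> glued (ev_rep p u) (ev_rep q u).
Proof.
move=> /asboolP; elim=> {p q} [p q pq|p|p q _|p q r _ pq _ qr].
- have iq : in_piece (piece_index (unzip2 (val q).2) (val u)) (unzip2 (val q).2) (val u).
    by apply: in_piece_index (valP u); have /andP[] := valP q.
  have [i ip gi] := glue_ev_string (valP p) (valP q) pq iq.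
  apply: (glued_trans (ev_rep_glued ip)).
  exact: (glued_step _ (ev_rep_subproof q u) gi).
- exact: glued_refl.
- by rewrite glued_sym.
- exact: glued_trans pq qr.
Qed.

Lemma ev_rep01 (p : point R LG) (u v : unit_interval R) :
  val u = 0 -> val v = 1 -> glued (ev_rep p u) (ev_rep p v).
Proof.
move=> u0 v1; have /andP[cp tp] := valP p.
have iu : in_piece (size (val p).2) (unzip2 (val p).2) (val u).
  rewrite /in_piece size_map leqnn u0 /= [nth 0 (unzip2 _) _]nth_default ?size_map // lexx andbT.
  by rewrite -(size_map (@snd _ _)); apply: le_trans (nth_desc tp (leqnSn _)); rewrite nth_default.
have iv : in_piece 0 (unzip2 (val p).2) (val v).
  by rewrite /in_piece v1 /= lexx; have := nth_desc tp (leqnSn 0).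
have hm : is_point (loop_base (val p).1, underlying_string (val p).2).
  by rewrite /is_point /= unzip1_underlying unzip2_underlying tp underlying_composable.
apply: (glued_trans (ev_rep_glued iu)); rewrite glued_sym.
apply: (glued_trans (ev_rep_glued iv)); rewrite glued_sym.
apply: (@glued_trans _ _ (mk_point hm)).
  apply: glued_step; rewrite /ev_string /insert_at u0.
  rewrite take_oversize ?drop_oversize ?size_map // cats1.
  exact: glue_last.
rewrite glued_sym; apply: glued_step; rewrite /ev_string /insert_at take0 drop0 /= v1.
set c := transport _ _ _ _.
have {2}<- : gtgt c = loop_base (val p).1.
  rewrite /c /transport take0 /gprod /=.
  by have [||_ ->] := @gconj_ends G (gid (loop_base (val p).1)) (val (val p).1);
    rewrite ?gsrc_id ?gtgt_id ?loop_ends.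
exact: glue_first.
Qed.

Lemma ev_pi i (p : point R LG) (u : unit_interval R)
    (h : in_piece i (unzip2 (val p).2) (val u)) :
  ev (\pi_(classifying_space R LG) p) (\pi_(circle R) u) =
  \pi_(classifying_space R G) (mk_point (ev_string_is_point (valP p) h)).
Proof.
apply/eqmodP; rewrite /ev /=.
set q := repr _; set v := repr _.
have qp : glued q p by apply/eqmodP; rewrite reprK.
have vu : circle_rel v u by apply/eqmodP; rewrite reprK.
apply: glued_trans (ev_rep_glued h); apply: glued_trans (glued_ev_rep u qp).
move: vu; rewrite /circle_rel => /orP[/eqP/val_inj -> |]; first exact: glued_refl.
case/andP=> /orP[] /eqP v0 /orP[] /eqP u0; try exact: ev_rep01.
- by rewrite (val_inj (etrans v0 (esym u0))); apply: glued_refl.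
- by rewrite glued_sym; apply: ev_rep01.
- by rewrite (val_inj (etrans v0 (esym u0))); apply: glued_refl.
Qed.

End Evaluation.

Section Transgression.
Variables (R : realType) (G : finGroupoid).
Local Notation LG := (loop_groupoid G).

Lemma size_insert_tuple (T : Type) n i (e : T) (t : n.-tuple T) :
  size (insert_at i e t) == n.+1.
Proof. by rewrite size_insert_at size_tuple. Qed.
Definition insert_tuple (T : Type) n i (e : T) (t : n.-tuple T) : n.+1.-tuple T :=
  Tuple (size_insert_tuple i e t).

(* [ev] carries the point of the piece t_i >= u >= t_{i+1} of the prism over s
   to the point of s' with coordinates (t_1, ..., t_i, u, t_{i+1}, ..., t_m). *)
Definition is_piece_image m (s : nsimplex LG m) (i : nat)
    (s' : nsimplex G m.+1) : Prop :=
  forall (t : m.-tuple R) (u : unit_interval R)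
    (ht : in_simplex t) (hu : in_piece i t (val u)),
    ev (simplex_point s ht) (\pi_(circle R) u) =
    simplex_point s' (in_simplex_insert ht hu : in_simplex (insert_tuple i (val u) t)).

(* The i-th piece has the ordered coordinates (t_1, ..., t_i, u, t_{i+1}, ..., t_m)
   and the product has (t_1, ..., t_m, u); this permutation sends a position in
   the former list to the position of the same coordinate in the latter. *)
Definition piece_perm m (i : 'I_m.+1) : 'S_m.+1 := lift_perm i ord_max 1.

Lemma tnth_insert_tuple m (i : 'I_m.+1) (u : R) (t : m.-tuple R) k :
  tnth (insert_tuple i u t) k = tnth [tuple of rcons t u] (piece_perm i k).
Proof.
rewrite !(tnth_nth 0) /= /piece_perm /insert_at.
have st : size (take i t) = i by rewrite size_takel // size_tuple -ltnS.
case: (unliftP i k) => [j ->|->].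
  rewrite lift_perm_lift perm1 lift_max nth_rcons size_tuple ltn_ord.
  rewrite nth_cat st /= /bump; case: (leqP i j) => ij /=.
    by rewrite add1n ltnNge (leq_trans ij) //= subSn //= nth_drop subnKC.
  by rewrite add0n ij nth_take.
rewrite lift_perm_id nth_rcons size_tuple ltnn eqxx.
by rewrite nth_cat st ltnn subnn.
Qed.

(* The inner sum has exactly one term, since the image of each piece determines
   the simplex onto which it is mapped. *)
Definition ev_prism m (s : nsimplex LG m) : chain G m.+1 :=
  \sum_(i < m.+1) \sum_(s' : nsimplex G m.+1 | `[< is_piece_image s i s' >])
    basis_chain s' *~ (-1) ^+ odd_perm (piece_perm i).

Definition transgression m (a : nsimplex G m.+1 -> R[i]) (s : nsimplex LG m) : R[i] :=
  on_chain a (ev_prism s).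

End Transgression.

Section LoopSimplex.
Variables (G : finGroupoid) (m : nat) (s : nsimplex (loop_groupoid G) m).

Let c : gmor G := val (sx_start s).
Let x : gobj G := loop_base (sx_start s).
Let gs : m.-tuple (gmor G) := [tuple of map (@loop_arrow G) (sx_arrows s)].

Lemma loop_insert_subproof (i : nat) : composable x (insert_at i (transport x gs c i) gs).
Proof.
apply: composable_insert; rewrite ?/c ?loop_ends //.
exact: underlying_composable (valP s).
Qed.

(* For s = [g_m|...|g_1]c, the simplex
   [g_m|...|g_{i+1}|(g_i...g_1) c (g_i...g_1)^-1|g_i|...|g_1]. *)
Definition loop_insert (i : nat) : nsimplex G m.+1 :=
  mk_simplex (size_insert_tuple i (transport x gs c i) gs) (loop_insert_subproof i).

End LoopSimplex.

(* Main.v *)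
Require Import Defs.
From mathcomp Require Import all_boot all_order all_algebra reals complex.
From mathcomp Require Import all_fingroup generic_quotient boolp.
Import Order.TTheory GRing.Theory Num.Theory.
Local Open Scope ring_scope.

(* The composite of the entries of a point sitting at a fixed time u in ]0, 1[ is
   invariant under the gluing relation, so an interior point of the classifying
   space with distinct coordinates determines its simplex; hence the image of
   each piece of the prism is exactly the simplex with the conjugated loop
   inserted at position i, with sign (-1)^(m - i).  The cocycle condition is the
   prism formula: in the alternating sum of the boundaries of the inserted
   simplices, the faces merging the loop with a neighbouring arrow cancel in
   pairs because (g c g^-1) g = g c, the two outer faces (both equal to the
   underlying string) cancel each other, and what is left is the prism over the
   boundary. *)

(** * Faces of a string with an inserted loop *)

Section LoopStrings.
Variable G : finGroupoid.
Local Notation LG := (loop_groupoid G).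

(** Recursive form of the inserted string: passing the arrow [g] replaces the loop by the target of
    [g] in the loop groupoid, so no conjugation by a product appears and inductions follow the
    string. *)
Fixpoint loop_string (c : gobj LG) (gs : seq (gmor LG)) (i : nat) {struct i} : seq (gmor G) :=
  match i, gs with
  | i'.+1, g :: gs' => loop_arrow g :: loop_string (gtgt g) gs' i'
  | _, _ => val c :: map (@loop_arrow G) gs
  end.

Lemma loop_base_gtgt (g : gmor LG) : loop_base (gtgt g) = gtgt (loop_arrow g).
Proof.
have [tg sg] := loop_mor_ends g.
by rewrite /loop_base /=; have [||-> _] := @gconj_ends G (val g).2 (val g).1;
  rewrite ?tg ?sg.
Qed.

(** Conjugating by g_i...g_1 is conjugating first by g_1, which gives the loop [gtgt g], and then by
    g_i...g_2. *)
Lemma insert_transport (c : gobj LG) gs i : (i <= size gs)%N -> composable c gs ->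
  insert_at i (transport (loop_base c) (map (@loop_arrow G) gs) (val c) i)
    (map (@loop_arrow G) gs) = loop_string c gs i.
Proof.
elim: gs c i => [|g gs IH] c [|i] //=.
- by rewrite /insert_at /transport /gprod /= loop_gconj1.
- by rewrite /insert_at /transport /gprod /= loop_gconj1.
rewrite ltnS => isz /andP[/eqP sg cgs]; rewrite -(IH _ _ isz cgs) /insert_at /=.
congr (_ :: (_ ++ _ :: _)).
have [tg0 sg0] := loop_mor_ends g.
have cu := underlying_composable cgs.
have ct := composable_take i cu.
rewrite /transport /= gprod_cons -?loop_base_gtgt //; last by rewrite -sg /loop_arrow sg0.
rewrite gconj_comp -?sg //.
- by have [-> _] := gprod_ends ct; rewrite loop_base_gtgt.
- by rewrite /loop_arrow sg0 -tg0.
Qed.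

Lemma map_merge_at k (c : gobj LG) gs : composable c gs ->
  map (@loop_arrow G) (merge_at k gs) = merge_at k (map (@loop_arrow G) gs).
Proof.
elim: k c gs => [|k IH] c [|g gs] //=; last by move=> /andP[_ /IH ->].
by case: gs => [|h gs] //= /and3P[_ /eqP e _]; rewrite gcomp_loop.
Qed.

(** Both merged arrows precede the loop, and carrying the loop past their composite gives the same
    result as carrying it past one after the other. *)
Lemma merge_loop_string_lt k i (c : gobj LG) gs : composable c gs ->
    (k < i)%N -> (i < size gs)%N ->
  merge_at k (loop_string c gs i.+1) = loop_string c (merge_at k gs) i.
Proof.
elim: k i c gs => [|k IH] [|i] c [|g gs] //=.
  case: gs => [|h gs] //= /and3P[_ /eqP e _] _ _.
  by rewrite loop_tgt_comp //; congr (_ :: _); rewrite gcomp_loop.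
by move=> /andP[_ cgs] ki isz; rewrite -IH.
Qed.

(** The loop precedes the affected entries and is left alone. This includes the face that drops the
    last arrow. *)
Lemma merge_loop_string_gt k i (c : gobj LG) gs : composable c gs ->
    (i <= k)%N ->
  merge_at k.+1 (loop_string c gs i) = loop_string c (merge_at k gs) i.
Proof.
elim: i k c gs => [|i IH] k c gs cgs ik.
  by rewrite /= (map_merge_at _ _ _ cgs).
case: k ik cgs => // k ik; case: gs => //= g gs /andP[_ cgs].
by rewrite -IH.
Qed.

Lemma merge_loop_string_diag i (c : gobj LG) gs : composable c gs ->
    (i < size gs)%N ->
  merge_at i (loop_string c gs i) = merge_at i (loop_string c gs i.+1).
Proof.
elim: i c gs => [|i IH] c [|g gs] //= /andP[/eqP sg cgs]; last first.
  by move=> isz; rewrite IH.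
move=> _; have [tg0 sg0] := loop_mor_ends g.
have E : gcomp (loop_arrow g) (val c) = gcomp (val (gtgt g)) (loop_arrow g).
  by rewrite -sg /= gconj_mulr // ?sg0 ?tg0.
by case: gs cgs => [|h gs] _ /=; rewrite E.
Qed.

Lemma merge_loop_string_last (c : gobj LG) gs :
  merge_at (size gs) (loop_string c gs (size gs)) = map (@loop_arrow G) gs.
Proof. by elim: gs c => //= g gs IH c; rewrite IH. Qed.

End LoopStrings.
Arguments loop_string {G} c gs i.

(** * Multiplicative extension of cochains to chains *)

Section Chains.
Variables (R : realType) (G : finGroupoid).

Section OnChain.
Variables (n : nat) (w : nsimplex G n -> R[i]).
Hypothesis w_neq0 : forall s, w s != 0.

Lemma on_chain0 : on_chain w 0 = 1.
Proof. by rewrite /on_chain big1 // => s _; rewrite ffunE expr0z. Qed.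

Lemma on_chainD c d : on_chain w (c + d) = on_chain w c * on_chain w d.
Proof.
by rewrite /on_chain -big_split; apply: eq_bigr => s _; rewrite ffunE expfzDr.
Qed.

Lemma on_chainMz c (e : int) : on_chain w (c *~ e) = on_chain w c ^ e.
Proof.
rewrite /on_chain; have -> : (c *~ e) = [ffun s => c s * e] :> chain G n.
  (* Splitting on the sign of [e] reduces integer multiples to natural ones, which are computed
     pointwise. *)
  apply/ffunP => s; rewrite ffunE; case: e => k.
    by rewrite -pmulrn ffunMnE -mulr_natr natz.
  by rewrite NegzE mulrNz -pmulrn ffunE ffunMnE mulrN -mulr_natr natz.
rewrite (big_morph (fun x : R[i] => x ^ e) (fun x y => expfzMl x y e) (exp1rz _ e)).
by apply: eq_bigr => s _; rewrite ffunE exprz_exp.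
Qed.

Lemma on_chain_sum (I : finType) (P : pred I) (F : I -> chain G n) :
  on_chain w (\sum_(i | P i) F i) = \prod_(i | P i) on_chain w (F i).
Proof. exact: (big_morph _ on_chainD on_chain0). Qed.

Lemma on_chain_basis s : on_chain w (basis_chain s) = w s.
Proof.
rewrite /on_chain (bigD1 s) //= ffunE eqxx expr1z big1 ?mulr1 // => s' ne.
by rewrite ffunE (negbTE ne) expr0z.
Qed.

End OnChain.
End Chains.

(** * Cancellation in the double sum of the prism formula *)

Section DoubleSum.
Variables (V : zmodType) (m : nat) (a b : nat -> nat -> V).
Hypothesis a_lt : forall i k, (k <= i)%N -> (i <= m)%N -> a i.+1 k = b i k.
Hypothesis a_gt : forall i k, (i < k)%N -> (k <= m.+1)%N -> a i k.+1 = b i k.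
Hypothesis a_diag : forall i, (i <= m)%N -> a i i.+1 = a i.+1 i.+1.
Hypothesis a_ends : a m.+1 m.+2 = a 0 0.

(** Row [i] splits into [k < i], [k > i + 1] and the two middle terms. The outer ranges give the
    right-hand side after an index shift that flips the sign; the middle terms telescope to zero. *)
Lemma signed_double_sum :
  \sum_(i < m.+2) \sum_(k < m.+3) a i k *~ (-1) ^+ (i + k) =
  - \sum_(i < m.+1) \sum_(k < m.+2) b i k *~ (-1) ^+ (i + k).
Proof.
pose f i k := a i k *~ (-1) ^+ (i + k).
pose h i k := b i k *~ (-1) ^+ (i + k).
have Ef i : (i <= m.+1)%N -> \sum_(k < m.+3) f i k =
    \sum_(0 <= k < i) f i k + \sum_(i.+2 <= k < m.+3) f i k + (f i i + f i i.+1).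
  move=> im; rewrite -(big_mkord predT) (big_cat_nat (n := i)) //=; last by rewrite leqW // leqW.
  rewrite -addrA; congr (_ + _).
  by rewrite big_ltn ?ltnS 1?leqW // big_ltn ?ltnS // addrA addrC.
have Eh i : (i <= m)%N -> \sum_(k < m.+2) h i k =
    \sum_(0 <= k < i.+1) h i k + \sum_(i.+1 <= k < m.+2) h i k.
  by move=> im; rewrite -(big_mkord predT) (big_cat_nat (n := i.+1)) //= leqW.
have f_lt i k : (k <= i)%N -> (i <= m)%N -> f i.+1 k = - h i k.
  by move=> ki im; rewrite /f a_lt // addSn exprS mulN1r mulrNz.
have f_gt i k : (i < k)%N -> (k <= m.+1)%N -> f i k.+1 = - h i k.
  by move=> ik km; rewrite /f a_gt // addnS exprS mulN1r mulrNz.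
have diag : \sum_(i < m.+2) (f i i + f i i.+1) = 0.
  (* Pairing [f i i.+1] with [f i.+1 i.+1] leaves [f 0 0] and [f m.+1 m.+2], whose signs are
     opposite since 2m+3 is odd. *)
  rewrite big_split /= big_ord_recl [X in _ + X]big_ord_recr /=.
  rewrite [X in X + _ = _]addrC addrACA -big_split /= big1.
    rewrite add0r /f a_ends -[in (-1) ^+ (_.+1 + _)]signr_odd addnS oddS !addnn.
    by rewrite odd_double subrr.
  move=> i _; rewrite /bump add1n /f (a_diag i (leq_ord i)).
  by rewrite addSn exprS mulN1r mulrNz addNr.
rewrite (eq_bigr _ (fun (i : 'I_m.+2) _ => Ef i (leq_ord i))) big_split /= diag addr0 big_split /=.
rewrite (eq_bigr _ (fun (i : 'I_m.+1) _ => Eh i (leq_ord i))) big_split /= opprD.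
rewrite -!sumrN; congr (_ + _).
  (* Below the diagonal row 0 is empty and the row index shifts; above it the last row is empty and
     the column index shifts. *)
  rewrite big_ord_recl big_geq // add0r; apply: eq_bigr => i _.
  rewrite -sumrN !big_nat; apply: eq_bigr => k /andP[_ ki].
  by rewrite f_lt // -ltnS.
rewrite big_ord_recr /= [X in _ + X]big_geq // addr0; apply: eq_bigr => i _.
rewrite -sumrN big_add1 /= !big_nat; apply: eq_bigr => k /andP[ik km].
by rewrite f_gt.
Qed.
End DoubleSum.

(** * A gluing invariant that separates simplices *)

Section Separation.
Variables (R : realType) (G : finGroupoid).
Implicit Types (u : R) (s : seq (gmor G * R)).

Definition arrows_at u s : seq (gmor G) := unzip1 [seq e <- s | e.2 == u].

(** An option, with the first arrow as seed of the fold, since an empty list of arrows does not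
    determine an object whose identity could serve as empty composite. *)
Definition arrow_at u s : option (gmor G) :=
  if arrows_at u s is g :: gs then Some (foldl (fun h g' => gcomp g' h) g gs)
  else None.

Lemma arrows_at_cat u s1 s2 : arrows_at u (s1 ++ s2) = arrows_at u s1 ++ arrows_at u s2.
Proof. by rewrite /arrows_at filter_cat /unzip1 map_cat. Qed.

Lemma arrows_at_cons u g t s :
  arrows_at u ((g, t) :: s) = if t == u then g :: arrows_at u s else arrows_at u s.
Proof. by rewrite /arrows_at /=; case: ifP. Qed.

(** Times decrease weakly along the string, so the entries at time [u] form a consecutive block. *)
Lemma composable_arrows_at u (x : gobj G) s (a : R) : path >=%R a (rcons (unzip2 s) 0) ->
  composable x (unzip1 s) -> exists y, composable y (arrows_at u s).
Proof.
elim: s x a => [|[g t] s IH] x a /=; first by exists x.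
move=> /andP[_ ps] /andP[/eqP sg cs]; rewrite arrows_at_cons; case: eqP => [tu|_].
  2: exact: IH _ _ ps cs.
exists x; rewrite /= sg eqxx /=; move: tu ps => -> {sg IH x t a}.
elim: s (gtgt g) cs => [|[h t] s IH] x //= /andP[sh cs] /andP[tu ps].
rewrite arrows_at_cons; case: eqP => [tE|/eqP ne].
  by rewrite /= sh IH // -{1}tE.
rewrite /arrows_at (_ : filter _ _ = [::]) //; apply/eqP.
rewrite -[_ == _]negbK -has_filter; apply/hasPn => -[k t'] /= kin.
have lt_tu : t < u by rewrite lt_neqAle ne.
have := order_path_min ge_trans ps => /allP/(_ t').
rewrite mem_rcons inE (map_f (@snd _ _) kin) orbT => /(_ isT) t't.
by rewrite lt_eqF // (le_lt_trans t't).
Qed.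

Lemma gtgt_foldl_gcomp (g : gmor G) gs : composable (gtgt g) gs ->
  gtgt (foldl (fun h g' => gcomp g' h) g gs) = endpoint (gtgt g) gs.
Proof.
elim: gs g => [|h gs IH] g //= /andP[/eqP sh cs].
by rewrite IH gtgt_comp.
Qed.

(** The outer faces remove entries at times 1 and 0 only, which differ from [u]; merging two entries
    at time [u] is associativity. *)
Lemma glue_arrow_at u (p q : raw_point R G) : 0 < u < 1 -> is_point p -> glue p q ->
  arrow_at u p.2 = arrow_at u q.2.
Proof.
move=> /andP[u0 u1] pp pq; case: pq pp => [x g s|x s1 g1 g2 t s2|x s g] /=.
- by rewrite /arrow_at arrows_at_cons gt_eqF.
- move=> /andP[/= cp tp]; have [y] := composable_arrows_at u _ _ _ tp cp.
  rewrite /arrow_at !arrows_at_cat !arrows_at_cons; case: eqP => // _.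
  case: (arrows_at u s1) => [|h hs] //=.
  rewrite composable_cat /= !foldl_cat /= => /andP[_ /and4P[ch /eqP s1h /eqP s12 _]].
  by rewrite gcompA // gtgt_foldl_gcomp.
- by rewrite /arrow_at -cats1 arrows_at_cat arrows_at_cons lt_eqF // cats0.
Qed.

Lemma glued_arrow_at u (p q : point R G) : 0 < u < 1 -> glued p q ->
  arrow_at u (val p).2 = arrow_at u (val q).2.
Proof.
move=> hu /asboolP; elim=> {p q} [p q pq|//|p q _ -> //|p q r _ -> _ -> //].
by apply: glue_arrow_at pq => //; apply: valP.
Qed.

Lemma arrows_at_zip (g0 : gmor G) gs (ts : seq R) k : uniq ts -> size gs = size ts ->
  (k < size ts)%N -> arrows_at (nth 0 ts k) (zip gs ts) = [:: nth g0 gs k].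
Proof.
elim: ts gs k => [|t ts IH] [|g gs] [|k] //= /andP[tn un] [sz] kt; rewrite arrows_at_cons.
  rewrite eqxx /arrows_at (_ : filter _ _ = [::]) //; apply/eqP.
  rewrite -[_ == _]negbK -has_filter; apply/hasPn => -[h t'] /= kin.
  apply: contra tn => /eqP <-; rewrite -(@unzip2_zip _ _ gs ts) ?sz //.
  exact: (map_f (@snd _ _) kin).
rewrite IH //; case: eqP => // tE; move: tn; rewrite tE mem_nth //.
Qed.

(** As the coordinates are distinct and interior, the invariant at the k-th coordinate is the k-th
    arrow alone. *)
Lemma simplex_point_inj n (s s' : nsimplex G n.+1) (t : n.+1.-tuple R) (ht : in_simplex t) :
  uniq t -> all (fun u => 0 < u < 1) t ->
  simplex_point s ht = simplex_point s' ht -> s = s'.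
Proof.
move=> ut /allP it /eqmodP gl.
have E : sx_arrows s = sx_arrows s'.
  apply: val_inj; pose g0 := thead (sx_arrows s).
  apply: (@eq_from_nth _ g0); rewrite ?size_tuple // => k kn.
  have kt : (k < size t)%N by rewrite size_tuple.
  have := glued_arrow_at _ _ _ (it _ (mem_nth 0 kt)) gl.
  by rewrite /arrow_at /= !(arrows_at_zip g0) ?size_tuple //= => -[].
apply: val_inj; rewrite [val s]surjective_pairing [val s']surjective_pairing.
congr (_, _); last exact: E.
(* There is at least one arrow, and the source of the first is the start. *)
move: E; case: s s' {gl} => [[x gs] /= cs] [[x' gs'] /= cs']; rewrite /sx_arrows /= => E.
by case: gs' E cs cs' => -[|g gs'] //= sz -> /andP[/eqP <- _] /andP[/eqP].
Qed.

End Separation.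

(** * The simplices onto which the prism pieces are mapped *)

Section PieceImages.
Local Open Scope quotient_scope.
Variables (R : realType) (G : finGroupoid) (m : nat).
Local Notation LG := (loop_groupoid G).

Lemma zip_insert_at (T U : Type) i (a : T) (b : U) s t : size s = size t ->
  zip (insert_at i a s) (insert_at i b t) = insert_at i (a, b) (zip s t).
Proof.
rewrite /insert_at; elim: s t i => [|x s IH] [|y t] [|i] //= [] /IH -> //.
Qed.

Lemma loop_insert_piece_image (s : nsimplex LG m) i :
  is_piece_image R s i (loop_insert s i).
Proof.
move=> t u ht hu.
pose p : point R LG := Sub (sx_start s, zip (sx_arrows s) t) (simplex_point_subproof s ht).
have h : in_piece i (unzip2 (val p).2) (val u) by rewrite /= unzip2_zip ?size_tuple.
rewrite /simplex_point (ev_pi (i := i) (p := p) h); congr (\pi _); apply: val_inj => /=.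
rewrite zip_insert_at ?size_map ?size_tuple // /ev_string /=.
have -> : underlying_string (zip (sx_arrows s) t) =
    zip (map (@loop_arrow G) (sx_arrows s)) t.
  move: (sx_arrows s) => gs.
  by elim: (val gs) (val t) => [|g l IH] [|r l'] //=; rewrite IH.
by rewrite unzip1_zip // size_map !size_tuple.
Qed.

Lemma interior_point n : exists t : n.-tuple R,
  [/\ in_simplex t, uniq t & all (fun u => 0 < u < 1) t].
Proof.
(* Equally spaced decreasing coordinates; [f n = 0] doubles as the closing coordinate t_{n+1}. *)
pose f k : R := (n - k)%:R / n.+1%:R.
have f_lt k l : (k < l)%N -> (l <= n)%N -> f l < f k.
  by move=> kl ln; rewrite /f ltr_pM2r ?invr_gt0 ?ltr0Sn // ltr_nat ltn_sub2l // (leq_trans kl).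
have f0 k : 0 <= f k by rewrite /f divr_ge0 ?ler0n.
have f1 k : f k < 1 by rewrite /f ltr_pdivrMr ?ltr0Sn // mul1r ltr_nat ltnS leq_subr.
exists [tuple f i | i < n].
have -> : [tuple f i | i < n] = mkseq f n :> seq R.
  by rewrite /mkseq -val_enum_ord -map_comp.
split.
- have fn : f n = 0 by rewrite /f subnn mul0r.
  rewrite /in_simplex -fn -mkseqS path_sortedE; last exact: ge_trans.
  apply/andP; split; first by apply/allP => _ /mapP[k _ ->]; rewrite /= ltW.
  apply/(sortedP 0) => k; rewrite size_mkseq => kn.
  by have kn1 := ltnW kn; rewrite !nth_mkseq //= ltW // f_lt // -ltnS.
- rewrite map_inj_in_uniq ?iota_uniq // => k l; rewrite !mem_iota !add0n => /= kn ln.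
  by case: (ltngtP k l) => // [kl|lk] fkl;
    [have := f_lt _ _ kl (ltnW ln)|have := f_lt _ _ lk (ltnW kn)];
    rewrite fkl ltxx.
- apply/allP => _ /mapP[k kin ->]; rewrite f1 andbT.
  move: kin; rewrite mem_iota add0n => /= kn; exact: le_lt_trans (f0 _) (f_lt _ _ kn (leqnn n)).
Qed.

(** One test point suffices: remove the coordinate of index [i] from an interior point [v] with
    distinct coordinates and use it as the circle parameter; [ev] then lands at [v] in both
    simplices. *)
Lemma piece_image_inj (s : nsimplex LG m) (i : 'I_m.+1) s' s'' :
  is_piece_image R s i s' -> is_piece_image R s i s'' -> s' = s''.
Proof.
have [v [hv uv iv]] := interior_point m.+1.
have iv_sz : (i < size v)%N by rewrite size_tuple.
have szt : size (take i v ++ drop i.+1 v) == m.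
  by rewrite size_cat size_takel ?size_drop ?size_tuple ?subSS ?subnKC ?leq_ord // ltnW.
have si : size (take i v) = i by rewrite size_takel // ltnW.
pose t : m.-tuple R := Tuple szt.
have u01 : 0 <= v`_i <= 1.
  by have /andP[u0 u1] := allP iv _ (mem_nth 0 iv_sz); rewrite !ltW.
pose u : unit_interval R := Sub v`_i u01.
have ins : insert_tuple i (val u) t = v.
  apply: val_inj; rewrite /= /insert_at.
  rewrite take_size_cat // drop_size_cat //.
  by rewrite -drop_nth // cat_take_drop.
have ht : in_simplex t.
  move: hv; rewrite /in_simplex /= -{1}(cat_take_drop i v) (drop_nth 0 iv_sz).
  rewrite !rcons_cat !cat_path => /andP[-> /=].
  case: (drop i.+1 v) => [|x l] /= /andP[a b]; first by rewrite !andbT in b *; apply: le_trans b a.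
  by case/andP: b => b ->; rewrite andbT; apply: le_trans b a.
have hu : in_piece i t (val u).
  rewrite /in_piece /= size_cat si.
  apply/and3P; split; first exact: leq_addr.
    have := nth_desc hv (leqnSn i); rewrite -cat_cons nth_cat /= si ltnS leqnn.
    by rewrite -[1 :: take i v]/(take i.+1 (1 :: v)) nth_take.
  rewrite nth_cat si ltnn subnn nth_drop addn0.
  by have := nth_desc hv (leqnSn i.+1).
move=> /(_ t u ht hu) e1 /(_ t u ht hu); rewrite e1.
move: (in_simplex_insert ht hu : in_simplex (insert_tuple i (val u) t)).
rewrite ins => hv'; exact: simplex_point_inj.
Qed.

Lemma ev_prism_loop_insert (s : nsimplex LG m) : ev_prism R s =
  \sum_(i < m.+1) basis_chain (loop_insert s i) *~ (-1) ^+ (m - i).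
Proof.
apply: eq_bigr => i _; rewrite (big_pred1 (loop_insert s i)).
  (* Lifting the identity so that [i] goes to the last position [m] gives parity [i + m], the same
     as that of [m - i]. *)
  rewrite /piece_perm odd_lift_perm odd_perm1 addbF -(signr_odd _ (m - i)).
  by rewrite oddB ?leq_ord // addbC.
move=> s' /=; apply/asboolP/eqP => [h|->]; last exact: loop_insert_piece_image.
exact: piece_image_inj h (loop_insert_piece_image s i).
Qed.

End PieceImages.

(** * The prism formula *)

Section PrismFormula.
Variables (R : realType) (G : finGroupoid).
Local Notation LG := (loop_groupoid G).

(** Basis chains indexed by bare strings, so that faces and insertions can be compared as lists
    without composability proofs. *)
Definition string_chain n (x : gobj G) (gs : seq (gmor G)) : chain G n :=
  [ffun s => ((sx_start s == x) && (sx_arrows s == gs :> seq _))%:R].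

Lemma basis_chain_string n (s : nsimplex G n) :
  basis_chain s = string_chain n (sx_start s) (sx_arrows s).
Proof.
by apply/ffunP => s'; rewrite !ffunE; congr (_%:R).
Qed.

Lemma basis_chain_loop_insert m (s : nsimplex LG m) (i : nat) : (i <= m)%N ->
  basis_chain (loop_insert s i) = string_chain m.+1 (loop_base (sx_start s))
    (loop_string (sx_start s) (sx_arrows s) i).
Proof.
move=> im; rewrite basis_chain_string /= insert_transport ?size_tuple //.
exact: (valP s).
Qed.

Lemma boundary_ev_prism m (s : nsimplex LG m.+1) :
  \sum_(k < m.+2) ev_prism R (face s k) *~ (-1) ^+ (m.+1 - k) =
  \sum_(i < m.+2) boundary (loop_insert s i) *~ (-1) ^+ (m + i).
Proof.
set c := sx_start s; set gs := sx_arrows s.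
have cgs : composable c gs := valP s.
have sz : size gs = m.+1 by rewrite size_tuple.
(* [a i k] is the k-th face of the string with the loop at position [i]; [b i k] inserts the loop at
   [i] into the k-th face. *)
pose a i k := string_chain m.+1 (face_start k (loop_base c) (loop_string c gs i))
  (face_arrows k (loop_string c gs i)).
pose b i k := string_chain m.+1 (loop_base (face_start k c gs))
  (loop_string (face_start k c gs) (face_arrows k gs) i).
have sgn (x : chain G m.+1) p q : odd p = odd q -> x *~ (-1) ^+ p = x *~ (-1) ^+ q.
  by move=> e; rewrite -signr_odd e signr_odd.
transitivity (- \sum_(i < m.+1) \sum_(k < m.+2) b i k *~ (-1) ^+ (i + k)).
  rewrite exchange_big -sumrN; apply: eq_bigr => k _.
  rewrite ev_prism_loop_insert mulrz_suml -sumrN; apply: eq_bigr => i _.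
  rewrite basis_chain_loop_insert ?leq_ord // -mulrzA -exprD -mulrNz -[- _ ^+ (i + k)]mulN1r -exprS.
  apply: sgn; rewrite /= oddD !oddB ?leq_ord // oddD /=.
  by case: (odd m); case: (odd i); case: (odd k).
rewrite -(@signed_double_sum _ m a b).
- apply: eq_bigr => i _; rewrite /boundary mulrz_suml; apply: eq_bigr => k _.
  rewrite -mulrzA -exprD basis_chain_string /=.
  rewrite [sx_start (face _ _)]/sx_start /= insert_transport ?sz ?leq_ord //.
  apply: sgn; rewrite !oddD oddB ?leq_ord //= negbK.
  by case: (odd m); case: (odd i); case: (odd k).
- move=> i [|k] ki im; rewrite /a /b /=.
    move: sz; case: (val gs) => // g gs' _ /=.
    by rewrite !take0 /endpoint [last _ _ in RHS]/= loop_base_gtgt.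
  by rewrite merge_loop_string_lt // sz.
- by move=> i [|k] // ki km; rewrite /a /b; congr string_chain; exact: merge_loop_string_gt.
- by move=> i im; rewrite /a /= merge_loop_string_diag // sz.
(* Both faces delete the loop itself; the starts agree because a loop ends at its base point. *)
- rewrite /a; congr string_chain; first by case: (val gs) => *; rewrite /= /endpoint /= loop_ends.
  have := merge_loop_string_last _ c gs; rewrite sz => E.
  by rewrite [LHS]E; case: (val gs).
Qed.

End PrismFormula.

Theorem theorem3 (R : realType) (G : finGroupoid) (m : nat)
    (alpha : nsimplex G m.+1 -> R[i]) (alphaZ : is_cocycle alpha) :
  is_cocycle (transgression alpha) /\
  forall s : nsimplex (loop_groupoid G) m,
    transgression alpha s =
    \prod_(i < m.+1) alpha (loop_insert s i) ^ ((-1) ^+ (m - i)).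
Proof.
have [[alpha1 alphaN] alphaB] := alphaZ.
have norm1_neq0 (z : R[i]) : `|z| = 1 -> z != 0.
  by move=> z1; rewrite -normr_eq0 z1 oner_eq0.
have alpha0 s : alpha s != 0 by exact/norm1_neq0/alpha1.
have tauE (s : nsimplex (loop_groupoid G) m) : transgression alpha s =
    \prod_(i < m.+1) alpha (loop_insert s i) ^ ((-1) ^+ (m - i)).
  rewrite /transgression ev_prism_loop_insert on_chain_sum //.
  by apply: eq_bigr => i _; rewrite on_chainMz // on_chain_basis.
have tau1 s : `|transgression alpha s| = 1.
  rewrite tauE normr_prod big1 // => i _.
  by rewrite -signr_odd; case: odd; rewrite ?expr1z ?exprN1 ?normfV alpha1 ?invr1.
split=> //; split; first split=> // s [c cin].
  rewrite tauE big1 // => i _; rewrite alphaN ?exp1rz //.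
  (* The identity of the loop [c] has the identity of its base point as underlying arrow, and
     insertion keeps every entry. *)
  exists (loop_base c).
  have : gid (loop_base c) \in map (@loop_arrow G) (sx_arrows s).
    exact: (map_f (@loop_arrow G) cin).
  by rewrite -{1}(cat_take_drop i (map _ _)) /= /insert_at !mem_cat inE => /orP[] ->; rewrite ?orbT.
move=> s; have tau0 s' : transgression alpha s' != 0 by exact/norm1_neq0/tau1.
(* Multiplicativity turns the transgression on the boundary into [alpha] on the prism over it, which
   by the prism formula is a signed sum of boundaries, where [alpha] is trivial. *)
transitivity (on_chain alpha
    (\sum_(k < m.+2) ev_prism R (face s k) *~ (-1) ^+ (m.+1 - k))).
  rewrite /boundary !on_chain_sum //; apply: eq_bigr => k _.
  by rewrite !on_chainMz // on_chain_basis.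
rewrite boundary_ev_prism on_chain_sum // big1 // => i _.
by rewrite on_chainMz // alphaB exp1rz.
Qed.
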